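(* Let $A$ be a non-zero positive bounded operator on a complex Hilbert space $\mathscr{H}$ and let $T\in\mathbb{B}_A(\mathscr{H})$. Then $$\frac12\|\Re_A(T^2)\|_A+\frac12 w_A(T)\,\big|\,\|\Re_A(T)\|_A-\|\Im_A(T)\|_A\big|\le w_A^2(T).$$
   Context: $\mathbb{B}(\mathscr{H})$ is the algebra of bounded linear operators on $\mathscr{H}$. For $x,y\in\mathscr{H}$, $\langle x,y\rangle_A=\langle Ax,y\rangle$ and $\|x\|_A=\langle Ax,x\rangle^{1/2}$. $\mathbb{B}_A(\mathscr{H})$ is the set (a subalgebra) of $T\in\mathbb{B}(\mathscr{H})$ for which there is $S\in\mathbb{B}(\mathscr{H})$ with $AS=T^*A$. For $T\in\mathbb{B}_A(\mathscr{H})$, $T^\sharp$ is the unique solution $X\in\mathbb{B}(\mathscr{H})$ of $AX=T^*A$ whose range is contained in $\overline{\mathcal{R}(A)}$. Put $\Re_A(T)=\frac12(T+T^\sharp)$ and $\Im_A(T)=\frac1{2i}(T-T^\sharp)$. The $A$-operator seminorm is $\|T\|_A=\sup\{\|Tx\|_A:\|x\|_A=1\}$ (finite for $T\in\mathbb{B}_A(\mathscr{H})$), and the $A$-numerical radius is $w_A(T)=\sup\{|\langle Tx,x\rangle_A|:\|x\|_A=1\}$; $w_A^2(T)$ means $(w_A(T))^2$. *)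

(* Defs.v *)
From HB Require Import structures.
From mathcomp Require Import all_boot all_order all_algebra complex.
From mathcomp Require Import boolp classical_sets functions reals topology.
From mathcomp Require Import normedtype.

Set Implicit Arguments.
Unset Strict Implicit.
Unset Printing Implicit Defensive.

Import Order.TTheory GRing.Theory Num.Theory.
Import numFieldNormedType.Exports.

Local Open Scope classical_set_scope.
Local Open Scope ring_scope.

(* A complex Hilbert space: a Banach space over R[i] whose norm comes from a
   positive definite Hermitian form, linear in its first argument and
   conjugate-linear in its second one. *)
HB.mixin Record CompleteNormedModule_isHilbert (R : realType) H
    & CompleteNormedModule R[i] H := {
  inner : {dot H for Num.conj} ;
  inner_norm : forall x : H, inner x x = `|x| ^+ 2
}.

#[short(type="hilbertType")]
HB.structure Definition Hilbert (R : realType) :=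
  {H of CompleteNormedModule R[i] H & CompleteNormedModule_isHilbert R H}.

Section SemiHilbertian.
Context {R : realType} {H : hilbertType R}.
Implicit Types (A S T X : H -> H) (x y : H).

Definition bounded_operators : set (H -> H) :=
  [set T | linear T /\ exists M : R, forall x, `|T x| <= M%:C%C * `|x|].

(* [get] picks the unique adjoint; the value is a junk one only when T is not
   a bounded operator. *)
Definition adjoint T : H -> H :=
  get [set S | bounded_operators S /\
    forall x y, inner (T x) y = inner x (S y)].

(* The order of R[i] is partial: [0 <= z] also says that z is real. *)
Definition positive_operator A : Prop :=
  bounded_operators A /\ forall x, 0 <= inner (A x) x.

Definition innerA A x y : R[i] := inner (A x) y.

(* <Ax, x> is a nonnegative real number when A is positive, so that taking the
   real part only moves it from R[i] to R. *)
Definition normA A x : R := Num.sqrt (complex.Re (innerA A x x)).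

Definition BA A : set (H -> H) :=
  [set T | bounded_operators T /\
    exists S, bounded_operators S /\ A \o S = adjoint T \o A].

(* Existence and uniqueness for T in [BA A] is Douglas' theorem; the value is
   a junk one for other T. *)
Definition sharp A T : H -> H :=
  get [set X | [/\ bounded_operators X, A \o X = adjoint T \o A
    & range X `<=` closure (range A)]].

Definition ReA A T : H -> H := fun x => 2^-1 *: (T x + sharp A T x).

Definition ImA A T : H -> H := fun x => (2 * 'i)^-1 *: (T x - sharp A T x).

(* For A positive and non-zero and T in [BA A], the two sets below are nonempty
   and bounded, hence these are genuine suprema. *)
Definition opnormA A T : R :=
  sup [set normA A (T x) | x in [set x | normA A x = 1]].

Definition numradiusA A T : R :=
  sup [set complex.Re `|innerA A (T x) x| | x in [set x | normA A x = 1]].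

End SemiHilbertian.

(* Main.v *)
(* Write T = P + iQ with P = Re_A(T) and Q = Im_A(T), both selfadjoint for the
   semi-inner product <., .>_A.  A selfadjoint operator B satisfies
   |Bx|_A <= c|x|_A as soon as |<Bx, x>_A| <= c<x, x>_A, so ||P||_A and ||Q||_A
   are at most w = w_A(T).  The form of Re_A(T^2) is |Px|_A^2 - |Qx|_A^2, which lies between
   -w^2|x|_A^2 and w^2|x|_A^2, so that ||Re_A(T^2)||_A <= w^2.  Since
   | ||P||_A - ||Q||_A | <= w, each summand on the left is at most w^2 / 2.
   What remains is to see that the suprema and the operators chosen in the
   definitions are genuine.  Adjoints, and the projection onto the closure of
   the range of A that turns a solution S of AS = T*A into T^sharp, come from
   the Riesz representation theorem, and w is finite because the selfadjoint
   operator B = T^sharp T satisfies |Bx|_A^(2^n) <= |B^(2^n) x|_A when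
   |x|_A = 1, so that |Bx|_A is at most the norm of B in B(H). *)
Require Import Defs.
From mathcomp Require Import all_boot all_order all_algebra complex.
From mathcomp Require Import boolp classical_sets functions reals topology.
From mathcomp Require Import normedtype interval_inference ring lra.

Import Order.TTheory GRing.Theory Num.Theory.
Import numFieldNormedType.Exports.

Local Open Scope classical_set_scope.
Local Open Scope ring_scope.

(** * Linear maps, complex scalars and a discriminant criterion *)

Section LinearMaps.
Context {K : pzRingType} {U V : lmodType K} {f : U -> V}.
Context (f_lin : linear f).

Lemma linear_fun0 : f 0 = 0.
Proof. by have := f_lin (-1) 0 0; rewrite scaler0 addr0 scaleN1r addNr. Qed.

Lemma linear_funD x y : f (x + y) = f x + f y.
Proof. by have := f_lin 1 x y; rewrite !scale1r. Qed.

Lemma linear_funZ a x : f (a *: x) = a *: f x.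
Proof. by have := f_lin a x 0; rewrite linear_fun0 !addr0. Qed.

End LinearMaps.

Lemma ReM_real {R : realType} (t : R) (z : R[i]) :
  complex.Re (t%:C%C * z) = t * complex.Re z.
Proof. by case: z => a b /=; rewrite mul0r subr0. Qed.

Lemma imaginaryE {R : realType} : 'i = 'i%C :> R[i].
Proof. by []. Qed.

Lemma Re_iM {R : realType} (z : R[i]) : complex.Re ('i * z) = - complex.Im z.
Proof. by rewrite imaginaryE; case: z => a b /=; rewrite mul0r mul1r sub0r. Qed.

(** If [c = 0] the polynomial is affine in [t], which forces [b = 0]; otherwise its value at the
    minimiser [t = - b / c] is [(a * c - b ^+ 2) / c]. *)
Lemma discriminant_le0 {R : realFieldType} (a b c : R) :
  0 <= a -> 0 <= c -> (forall t, 0 <= a + 2 * t * b + t ^+ 2 * c) ->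
  b ^+ 2 <= a * c.
Proof.
move=> a0 c0 q.
have [c_eq0|c_neq0] := eqVneq c 0.
  rewrite c_eq0 mulr0; have [->|b0] := eqVneq b 0; first by rewrite expr0n.
  (* At this [t] the affine polynomial takes the value [-1]. *)
  have := q (- (a + 1) / (2 * b)); rewrite c_eq0 mulr0 addr0.
  have -> : 2 * (- (a + 1) / (2 * b)) * b = - (a + 1) by field.
  lra.
have c_gt0 : 0 < c by rewrite lt_neqAle eq_sym c_neq0.
have := q (- b / c).
have -> : a + 2 * (- b / c) * b + (- b / c) ^+ 2 * c = (a * c - b ^+ 2) / c.
  by field.
by rewrite pmulr_lge0 ?invr_gt0// subr_ge0.
Qed.

(** * The semi-inner product of a positive operator and Cauchy-Schwarz *)

Section Forms.
Context {R : realType} {H : hilbertType R}.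
Implicit Types (A S T X : H -> H) (x y z : H) (t : R).

Lemma innerC x y : inner x y = Num.conj (inner y x).
Proof. by rewrite hermC expr0 mul1r. Qed.

(** The real part determines the form, whose imaginary part is [reA A x ('i *: y)], and its values
    lie in the ordered field [R], where [lra] applies. *)
Definition reA A x y : R := complex.Re (innerA A x y).

Lemma reADr A x y z : reA A x (y + z) = reA A x y + reA A x z.
Proof. by rewrite /reA /innerA linearDr raddfD. Qed.

Lemma reAZr A t x y : reA A x (t%:C%C *: y) = t * reA A x y.
Proof.
rewrite /reA /innerA linearZr_LR /= -[Num.conj _]/(conjc t%:C%C).
by rewrite conjc_real ReM_real.
Qed.

Lemma reA_ir A x y : reA A x ('i *: y) = complex.Im (innerA A x y).
Proof.
rewrite /reA /innerA linearZr_LR /= conjCi mulNr raddfN /=.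
by rewrite Re_iM opprK.
Qed.

Lemma innerA_reA A x y : innerA A x y = (reA A x y +i* reA A x ('i *: y))%C.
Proof. by rewrite reA_ir /reA; case: innerA. Qed.

Lemma norm_innerA A x y :
  complex.Re `|innerA A x y| =
  Num.sqrt (reA A x y ^+ 2 + reA A x ('i *: y) ^+ 2).
Proof. by rewrite innerA_reA normc_def. Qed.

Lemma positive_operator_id : positive_operator (@id H).
Proof.
split; last by move=> x; rewrite inner_norm exprn_ge0.
by split=> //; exists 1 => x; rewrite mul1r.
Qed.

Section Positive.
Context {A : H -> H}.
Context (A_pos : positive_operator A).

Lemma positive_linear : linear A. Proof. by case: A_pos => -[]. Qed.
Let A_lin := positive_linear.

(** Polarization: that <Az, z> is real for z = x, y, x + y and x + iy gives linear equations between
    the real and imaginary parts of <Ax, y> and <Ay, x>. *)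
Lemma positive_herm x y : inner (A x) y = inner x (A y).
Proof.
have Im0 z : complex.Im (inner (A z) z) = 0.
  by case: A_pos => _ /(_ z) /ger0_Im.
rewrite [RHS]innerC.
have h1 := Im0 (x + y); have h2 := Im0 (x + 'i *: y).
move: h1 h2 (Im0 x) (Im0 y).
rewrite !(linear_funD A_lin) (linear_funZ A_lin).
rewrite !(linearDl, linearDr) /= !(linearZl_LR, linearZr_LR) /=.
rewrite conjCi imaginaryE.
case: (inner (A x) x) => a1 a2; case: (inner (A y) y) => b1 b2.
case: (inner (A x) y) => c1 c2; case: (inner (A y) x) => d1 d2 /=.
move=> h1 h2 h3 h4; rewrite -[Num.conj _]/(conjc (d1 +i* d2)%C) /=.
by congr Complex; lra.
Qed.

Lemma reAC x y : reA A x y = reA A y x.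
Proof.
rewrite /reA /innerA positive_herm innerC.
by rewrite -[Num.conj _]/(conjc (inner (A y) x)); case: (inner _ _).
Qed.

Lemma reA_ge0 x : 0 <= reA A x x.
Proof.
case: A_pos => _ /(_ x); rewrite /reA /innerA.
by case: (inner _ _) => a b; rewrite lecE /= => /andP[].
Qed.

Lemma reADl x y z : reA A (x + y) z = reA A x z + reA A y z.
Proof. by rewrite reAC reADr !(reAC z). Qed.

Lemma reAZl t x y : reA A (t%:C%C *: x) y = t * reA A x y.
Proof. by rewrite reAC reAZr (reAC y). Qed.

Lemma reANr x y : reA A x (- y) = - reA A x y.
Proof. by rewrite /reA /innerA linearNr raddfN. Qed.

Lemma reANl x y : reA A (- x) y = - reA A x y.
Proof. by rewrite reAC reANr reAC. Qed.

Lemma reA_il x y : reA A ('i *: x) y = - reA A x ('i *: y).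
Proof.
rewrite reA_ir /reA /innerA (linear_funZ A_lin) linearZl_LR.
exact: Re_iM.
Qed.

Lemma normA_ge0 x : 0 <= normA A x. Proof. exact: sqrtr_ge0. Qed.

Lemma sqr_normA x : normA A x ^+ 2 = reA A x x.
Proof. by rewrite /normA sqr_sqrtr //; exact: reA_ge0. Qed.

Lemma normAN x : normA A (- x) = normA A x.
Proof. by rewrite /normA -!/(reA _ _ _) reANl reANr opprK. Qed.

Lemma normAZ t x : normA A (t%:C%C *: x) = `|t| * normA A x.
Proof.
rewrite /normA -!/(reA _ _ _) reAZl reAZr mulrA.
by rewrite sqrtrM -?expr2 ?sqr_ge0// sqrtr_sqr.
Qed.

Lemma reA_cauchy_schwarz_sqr x y : reA A x y ^+ 2 <= reA A x x * reA A y y.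
Proof.
have q t : 0 <= reA A x x + 2 * t * reA A x y + t ^+ 2 * reA A y y.
  have := reA_ge0 (x + t%:C%C *: y).
  by rewrite !(reADl, reADr, reAZl, reAZr) (reAC y x); lra.
exact: discriminant_le0 (reA_ge0 x) (reA_ge0 y) q.
Qed.

Lemma reA_cauchy_schwarz x y : `|reA A x y| <= normA A x * normA A y.
Proof.
rewrite -(ler_pXn2r (ltn0Sn 1)) ?nnegrE ?mulr_ge0 ?normA_ge0//.
by rewrite real_normK ?num_real// exprMn !sqr_normA reA_cauchy_schwarz_sqr.
Qed.

End Positive.

(** The norm of [H] with values in [R]. Taking [A = id] makes the results on positive operators
    available for it. *)
Definition norm1 x : R := normA id x.

Lemma norm1E x : `|x| = (norm1 x)%:C%C.
Proof.
have Re_norm : (complex.Re `|x|)%:C%C = `|x| by rewrite RRe_real// normr_real.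
rewrite /norm1 /normA /innerA inner_norm -Re_norm -rmorphXn /=.
by rewrite sqrtr_sqr ger0_norm // -ler0c Re_norm.
Qed.

End Forms.

(** * The real-valued norm, bounded operators and completeness *)

Section Hilbert.
Context {R : realType} {H : hilbertType R}.
Implicit Types (A S T X : H -> H) (x y z : H) (t : R).

Notation re1 := (@reA R H id).
Let id_pos := @positive_operator_id R H.

Lemma norm1_ge0 x : 0 <= norm1 x. Proof. exact: normA_ge0. Qed.

Lemma norm1_eq0 x : norm1 x = 0 -> x = 0.
Proof. by have := norm1E x => /[swap] ->; exact: normr0_eq0. Qed.

Lemma sqr_norm1 x : norm1 x ^+ 2 = re1 x x.
Proof. exact: sqr_normA. Qed.

Lemma ler_norm1 (M : R) x y :
  (`|x| <= M%:C%C * `|y|) = (norm1 x <= M * norm1 y).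
Proof. by rewrite !norm1E -rmorphM /= lecR. Qed.

Lemma bounded_operator_gt0 T : bounded_operators T ->
  exists2 M : R, 0 < M & forall x, norm1 (T x) <= M * norm1 x.
Proof.
move=> [_ [M TM]]; exists (`|M| + 1) => [|x]; first by rewrite ltr_wpDl.
move: (TM x); rewrite ler_norm1 => /le_trans; apply.
by rewrite ler_wpM2r ?norm1_ge0// (le_trans (ler_norm M))// lerDl.
Qed.

Lemma bounded_operator_norm1 T (M : R) : linear T ->
  (forall x, norm1 (T x) <= M * norm1 x) -> bounded_operators T.
Proof. by move=> T_lin TM; split=> //; exists M => x; rewrite ler_norm1. Qed.

Lemma bounded_comp S T :
  bounded_operators S -> bounded_operators T -> bounded_operators (S \o T).
Proof.
move=> S_bnd T_bnd.
have [M M0 SM] := bounded_operator_gt0 _ S_bnd.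
have [N N0 TN] := bounded_operator_gt0 _ T_bnd.
apply: (@bounded_operator_norm1 _ (M * N)) => [a x y /=|x].
  by case: S_bnd => S_lin _; case: T_bnd => T_lin _; rewrite T_lin S_lin.
by rewrite (le_trans (SM _))// -mulrA ler_pM2l.
Qed.

Lemma cauchy_norm1_cvg (u : nat -> H) :
  (forall e : R, 0 < e ->
    exists N, forall n, (N <= n)%N -> norm1 (u N - u n) < e) ->
  exists l : H, u @ \oo --> l /\
    forall e : R, 0 < e -> \forall n \near \oo, norm1 (l - u n) < e.
Proof.
move=> u_cauchy.
have /cauchy_cvgP u_cvg : cauchy (u @ \oo).
  apply: cauchy_exP => e e0.
  have Re_e : (complex.Re e)%:C%C = e by rewrite RRe_real// gtr0_real.
  have [|N uN] := u_cauchy (complex.Re e); first by rewrite -ltcR Re_e.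
  exists (u N); exists N => // n /= Nn.
  by rewrite -ball_normE /ball_ /= norm1E -Re_e ltcR uN.
exists (lim (u @ \oo)); split=> // e e0.
have e0C : 0 < e%:C%C :> R[i] by rewrite ltcR.
move/cvgrPdist_lt/(_ _ e0C): u_cvg.
by apply: filterS => n; rewrite norm1E ltcR.
Qed.

End Hilbert.

Lemma near_natSinv_lt {R : archiRealFieldType} (e : R) : 0 < e ->
  \forall n \near \oo, n.+1%:R^-1 < e.
Proof. by move: e => _/posnumP[e]; exact: near_infty_natSinv_lt. Qed.

(** * Riesz representation on closed subspaces *)

Section Riesz.
Context {R : realType} {H : hilbertType R}.
Implicit Types (A S T X : H -> H) (x y z v : H) (t : R).

Notation re1 := (@reA R H id).
Let id_pos := @positive_operator_id R H.
Let re1C := reAC id_pos.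
Let re1Dl := reADl id_pos.
Let re1Nl := reANl id_pos.
Let re1Zl := reAZl id_pos.

(** Variational argument: a sequence in [V] minimising [J x], that is |x|^2 - 2 g(x), is Cauchy, and
    its limit represents [g] on [V]. *)
Lemma real_riesz (V : set H) (g : H -> R) (M : R) :
  closed V -> V 0 ->
  (forall t x y, V x -> V y -> V (x + t%:C%C *: y)) ->
  (forall x y, g (x + y) = g x + g y) ->
  (forall t x, g (t%:C%C *: x) = t * g x) ->
  (forall x, g x <= M * norm1 x) ->
  exists2 y, V y & forall v, V v -> g v = re1 y v.
Proof.
move=> V_closed V0 VP gD gZ gM.
pose J x := re1 x x - 2 * g x.
pose E := [set J x | x in V]; pose d := inf E.
have E_inf : has_inf E.
  split; first by exists (J 0), 0.
  (* Completing the square: J(x) >= |x|^2 - 2M|x| >= -M^2. *)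
  exists (- M ^+ 2) => _ [x _ <-]; rewrite /J -(sqr_norm1 x).
  by have := gM x; have := sqr_ge0 (M - norm1 x); lra.
have J_ge x : V x -> d <= J x.
  by move=> Vx; apply: ge_inf; [case: E_inf|exists x].
have u_ex n : exists x, V x /\ J x < d + n.+1%:R^-1.
  have [|_ [x Vx <-] ?] := inf_adherent (eps := (n.+1%:R^-1 : R)) _ E_inf.
    by rewrite invr_gt0.
  by exists x.
have {u_ex} [u /all_and2[Vu uJ]] := choice u_ex.
have u_cauchy (e : R) : 0 < e ->
    exists N, forall n, (N <= n)%N -> norm1 (u N - u n) < e.
  (* By the parallelogram law |u_N - u_n|^2 = 2 J(u_N) + 2 J(u_n) - 4 J(m) with m the midpoint,
     which is below 4/(N+1) because J(m) >= d. *)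
  move=> e0; have e40 : 0 < e ^+ 2 / 4 by rewrite divr_gt0// exprn_gt0.
  have [N _ /(_ N (leqnn N)) /= Ne] := near_natSinv_lt _ e40.
  exists N => n Nn; rewrite -(ltr_pXn2r (ltn0Sn 1)) ?nnegrE ?norm1_ge0 ?ltW//.
  have nN : n.+1%:R^-1 <= N.+1%:R^-1 :> R by rewrite lef_pV2 ?posrE// ler_nat.
  have Vmid : V ((2^-1)%:C%C *: (u N + u n)).
    rewrite -[_ *: _]add0r; apply: (VP) => //.
    rewrite -[u n]scale1r -[1]/((1 : R)%:C%C); exact: VP.
  have := J_ge _ Vmid; have := uJ N; have := uJ n.
  rewrite sqr_norm1 /J gZ gD.
  rewrite !(re1Zl, re1Dl, re1Nl, reAZr, reADr, reANr) (re1C (u n)) //.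
  move: nN Ne; set a := n.+1%:R^-1; set b := N.+1%:R^-1; lra.
have {u_cauchy} [y [uy uy_norm]] := cauchy_norm1_cvg _ u_cauchy.
exists y => [|v Vv].
  by apply: (@closed_cvg _ _ _ _ u V V_closed _ y uy); exact: nearW.
have v0 := reA_ge0 id_pos v.
(* Approximate Euler equation: J(u_n + tv) >= d > J(u_n) - 1/(n+1) for every t, so a quadratic
   polynomial in t is nonnegative. *)
have key n : (re1 (u n) v - g v) ^+ 2 <= n.+1%:R^-1 * re1 v v.
  apply: discriminant_le0 => //.
  move=> t; have := J_ge _ (VP t _ _ (Vu n) Vv); have := uJ n.
  rewrite /J gD gZ !(re1Zl, re1Dl, reAZr, reADr) (re1C v) //.
  by set a := n.+1%:R^-1; lra.
apply/eqP; rewrite -subr_eq0; apply/eqP; set D := g v - re1 y v.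
have [//|D_neq0] := eqVneq D 0.
have D20 : 0 < D ^+ 2 by rewrite lt_neqAle sqr_ge0 eq_sym sqrf_eq0 D_neq0.
(* The estimates below give D^2 <= 4|v|^2 eta, whereas D^2 = (4|v|^2 + 1) eta by this choice; hence
   a contradiction with eta > 0. *)
pose eta := D ^+ 2 / (4 * re1 v v + 1).
have den0 : 0 < 4 * re1 v v + 1 by lra.
have eta0 : 0 < eta by rewrite divr_gt0.
have [n [neta yeta]] : exists n,
    n.+1%:R^-1 < eta /\ norm1 (y - u n) < Num.sqrt eta.
  have /filter_ex// : \forall n \near \oo,
      n.+1%:R^-1 < eta /\ norm1 (y - u n) < Num.sqrt eta.
  apply: filterS2 (near_natSinv_lt _ eta0) (uy_norm (Num.sqrt eta) _) => //.
  by rewrite sqrtr_gt0.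
have {}yeta : re1 (y - u n) (y - u n) < eta.
  rewrite -sqr_norm1 -[ltRHS]sqr_sqrtr ?ltW//.
  by rewrite ltr_pXn2r// nnegrE ?norm1_ge0 ?sqrtr_ge0.
have DE : D = - (re1 (u n) v - g v) - re1 (y - u n) v.
  by rewrite /D re1Dl re1Nl; lra.
have kn := key n; have cs := reA_cauchy_schwarz_sqr id_pos (y - u n) v.
have D2_le : D ^+ 2 <= 4 * re1 v v * eta.
  have h1 : n.+1%:R^-1 * re1 v v <= eta * re1 v v by rewrite ler_wpM2r// ltW.
  have h2 : re1 (y - u n) (y - u n) * re1 v v <= eta * re1 v v.
    by rewrite ler_wpM2r// ltW.
  rewrite DE; set b := re1 (u n) v - g v in kn *.
  set c := re1 (y - u n) v in cs *.
  move: kn h1; set a := n.+1%:R^-1; have := sqr_ge0 (b - c); lra.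
have etaE : eta * (4 * re1 v v + 1) = D ^+ 2 by rewrite /eta divfK// gt_eqF.
lra.
Qed.

(** The vector representing the real part of [f] represents [f] itself: evaluation at ['i *: v]
    matches the imaginary parts. *)
Lemma riesz (V : set H) (f : H -> R[i]) (M : R) :
  closed V -> V 0 ->
  (forall a x y, V x -> V y -> V (x + a *: y)) ->
  (forall x y, f (x + y) = f x + f y) ->
  (forall a x, f (a *: x) = a * f x) ->
  (forall x, complex.Re (f x) <= M * norm1 x) ->
  exists2 y, V y & forall v, V v -> f v = inner v y.
Proof.
move=> V_closed V0 VP fD fZ fM.
have [|x y|t x|//|y Vy yf] :=
  real_riesz V (fun x => complex.Re (f x)) M V_closed V0.
- by move=> t x y; exact: VP.
- by rewrite /= fD raddfD.
- by rewrite /= fZ ReM_real.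
exists y => // v Vv.
have Ref w : V w -> complex.Re (f w) = complex.Re (inner w y).
  by move=> Vw; rewrite [LHS](yf _ Vw) re1C.
have Vi : V ('i *: v) by rewrite -[_ *: _]add0r; exact: VP.
have := Ref _ Vi; rewrite fZ linearZl_LR /= !Re_iM => /oppr_inj Im_eq.
apply/eqP; rewrite eq_complex Ref// Im_eq !eqxx //.
Qed.

End Riesz.

(** * Adjoints and the operator [sharp A T] *)

Section Adjoint.
Context {R : realType} {H : hilbertType R}.
Implicit Types (A S T X : H -> H) (x y z v : H) (t : R).

Lemma inner_self_eq0 x : inner x x = 0 -> x = 0.
Proof.
move=> x0; apply: norm1_eq0; apply/eqP; rewrite -(@sqrf_eq0 R) sqr_norm1.
by rewrite /reA /innerA x0.
Qed.

Lemma inner_injr x y : (forall v, inner v x = inner v y) -> x = y.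
Proof.
move=> xy; apply/eqP; rewrite -subr_eq0; apply/eqP/inner_self_eq0.
by rewrite linearBr /= xy subrr.
Qed.

(* S is T* followed by the orthogonal projection onto V. *)
Lemma exists_adjoint_into (V : set H) T :
  closed V -> V 0 -> (forall a x y, V x -> V y -> V (x + a *: y)) ->
  bounded_operators T ->
  exists S, [/\ bounded_operators S, forall y, V (S y) &
    forall v y, V v -> inner (T v) y = inner v (S y)].
Proof.
move=> V_closed V0 VP T_bnd; have [T_lin _] := T_bnd.
have [M M0 TM] := bounded_operator_gt0 _ T_bnd.
have ReM v y : complex.Re (inner (T v) y) <= M * norm1 v * norm1 y.
  apply: le_trans (ler_norm _) _.
  apply: le_trans (reA_cauchy_schwarz (@positive_operator_id R H) _ _) _.
  by rewrite ler_wpM2r ?normA_ge0// TM.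
have S_ex y : exists z, V z /\ forall v, V v -> inner (T v) y = inner v z.
  have [x z|a x|x|z Vz zT] :=
    riesz V (fun x => inner (T x) y) (M * norm1 y) V_closed V0 VP.
  - by rewrite (linear_funD T_lin) linearDl.
  - by rewrite (linear_funZ T_lin) linearZl_LR.
  - by rewrite mulrAC.
  by exists z.
have [S /all_and2[VS TS]] := choice S_ex.
exists S; split=> //; last by move=> v y; exact: TS.
apply: (bounded_operator_norm1 _ M) => [a x y|y].
  (* The defect of linearity [z] lies in [V] and is orthogonal to [V], hence vanishes. *)
  apply/eqP; rewrite -subr_eq0; apply/eqP; set z := LHS.
  have Vz : V z.
    have -> : z = S (a *: x + y) + -1 *: S y + - a *: S x.
      by rewrite /z scaleN1r scaleNr opprD addrA addrAC.
    by do 2 apply: (VP) => //.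
  have zE v : V v -> inner v z = 0.
    move=> Vv; rewrite /z !(linearBr, linearDr) /= !linearZr_LR /=.
    by rewrite -!TS// linearDr linearZr_LR /= subrr.
  exact: inner_self_eq0 (zE _ Vz).
(* |Sy|^2 = <TSy, y> <= M |Sy| |y|, then division by |Sy|. *)
have [->|Sy0] := eqVneq (norm1 (S y)) 0.
  by rewrite mulr_ge0 ?normA_ge0 ?ltW.
rewrite -(@ler_pM2l _ (norm1 (S y))) ?lt_neqAle ?normA_ge0 1?eq_sym ?Sy0//.
rewrite -expr2 sqr_norm1 mulrA [norm1 _ * M]mulrC.
by apply: le_trans (ReM _ _); rewrite TS.
Qed.

Lemma adjointP T : bounded_operators T ->
  bounded_operators (adjoint T) /\
  forall x y, inner (T x) y = inner x (adjoint T y).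
Proof.
move=> T_bnd; rewrite -/([set S | bounded_operators S /\
  forall x y, inner (T x) y = inner x (S y)] _); apply: getPex.
have [//|S [S_bnd _ TS]] := exists_adjoint_into setT T closedT Logic.I _ T_bnd.
by exists S; split=> // x y; exact: TS.
Qed.

Lemma adjoint_comp S T : bounded_operators S -> bounded_operators T ->
  adjoint (S \o T) = adjoint T \o adjoint S.
Proof.
move=> S_bnd T_bnd; apply/funext => y; apply: inner_injr => v /=.
have [_ <-] := adjointP _ (bounded_comp _ _ S_bnd T_bnd).
by have [_ <-] := adjointP _ T_bnd; have [_ <-] := adjointP _ S_bnd.
Qed.

Lemma BA_comp A S T : BA A S -> BA A T -> BA A (S \o T).
Proof.
move=> [S_bnd [S' [S'_bnd AS']]] [T_bnd [T' [T'_bnd AT']]].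
split; first exact: bounded_comp.
exists (T' \o S'); split; first exact: bounded_comp.
by rewrite adjoint_comp// compA AT' -compA AS' compA.
Qed.

(** A continuous map sending [range A] into its closure sends the whole closure there; this is
    applied first in [x], then in [y]. *)
Lemma closure_range_subspace A : linear A ->
  forall a x y, closure (range A) x -> closure (range A) y ->
  closure (range A) (x + a *: y).
Proof.
move=> A_lin a.
have closed_shift (f : H -> H) : continuous f ->
    (forall x, range A x -> closure (range A) (f x)) ->
    forall x, closure (range A) x -> closure (range A) (f x).
  move=> f_cont Af.
  suff : closure (range A) `<=` f @^-1` closure (range A) by [].
  rewrite {1}closureE; apply: smallest_sub Af.
  by apply: preimage_closed => [x _|]; [exact: f_cont|exact: closed_closure].
move=> x y Vx Vy; move: x Vx; apply: (closed_shift) => [x|x Ax].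
  by apply: cvgD; [exact: cvg_id|exact: cvg_cst].
move: y Vy; apply: (closed_shift) => [y|y Ay].
  by apply: cvgD; [exact: cvg_cst|apply: cvgZr; exact: cvg_id].
apply: subset_closure; case: Ax => u _ <-; case: Ay => v _ <-.
by exists (u + a *: v) => //; rewrite (linear_funD A_lin) (linear_funZ A_lin).
Qed.

Section Sharp.
Context {A T : H -> H}.
Context (A_pos : positive_operator A) (T_BA : BA A T).

Lemma sharpP : bounded_operators (sharp A T) /\
  A \o sharp A T = adjoint T \o A.
Proof.
suff /getPex[] : exists X, [set X | [/\ bounded_operators X,
    A \o X = adjoint T \o A & range X `<=` closure (range A)]] X by [].
have A_lin := positive_linear A_pos.
case: T_BA => _ [S [S_bnd AS]].
have V0 : closure (range A) 0.
  by apply: subset_closure; exists 0 => //; exact: linear_fun0.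
have [id_bnd _] := @positive_operator_id R H.
have [P [P_bnd VP AP]] := exists_adjoint_into _ id (@closed_closure _ (range A))
  V0 (closure_range_subspace _ A_lin) id_bnd.
exists (P \o S); split.
- exact: bounded_comp.
(* [P] is the orthogonal projection onto the closure of the range, so <Av, PSx> = <Av, Sx> and
   projecting leaves AS unchanged. *)
- rewrite -AS; apply/funext => x; apply: inner_injr => v /=.
  rewrite -!(positive_herm A_pos) -AP//.
  by apply: subset_closure; exists v.
- by move=> _ [x _ <-]; exact: VP.
Qed.

(** Boundedness and this adjoint relation are all that the later estimates use about [sharp A T];
    they are carried out for any such operator [X]. *)
Lemma reA_sharp x y : reA A (sharp A T x) y = reA A x (T y).
Proof.
have [_ /(congr1 (@^~ x)) /= AX] := sharpP.
have [T_bnd _] := T_BA; have [_ Tadj] := adjointP _ T_bnd.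
rewrite (reAC A_pos) [RHS](reAC A_pos) /reA /innerA.
by rewrite !(positive_herm A_pos) AX Tadj.
Qed.

End Sharp.
End Adjoint.

(** * Growth of powers and suprema of real sets *)

Lemma le_of_exp2n_bound {R : archiRealFieldType} (q M C : R) :
  0 < M -> (forall n, q ^+ (2 ^ n) <= C * M ^+ (2 ^ n)) -> q <= M.
Proof.
move=> M0 qC; rewrite leNgt; apply/negP => Mq.
(* If [M < q] then [r > 1], and Bernoulli's inequality pushes [r ^+ (2 ^ n)] beyond [C]. *)
pose r := q / M; have r1 : 0 < r - 1 by rewrite subr_gt0 ltr_pdivlMr// mul1r.
have rC n : r ^+ (2 ^ n) <= C.
  by rewrite /r expr_div_n ler_pdivrMr ?exprn_gt0.
have bernoulli n : 1 + n%:R * (r - 1) <= r ^+ n.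
  elim: n => [|n IHn]; first by rewrite mul0r addr0 expr0.
  have r0 : 0 <= r by lra.
  rewrite exprS; apply: le_trans (ler_wpM2l r0 IHn).
  rewrite -natr1; have n0 := ler0n R n.
  by have := mulr_ge0 n0 (sqr_ge0 (r - 1)); lra.
pose N := Num.bound `|C / (r - 1)|.
have CN : C < N%:R * (r - 1).
  by rewrite -ltr_pdivrMr//; apply: le_lt_trans (ler_norm _) _;
    exact: archi_boundP.
have := le_trans (bernoulli (2 ^ N)%N) (rC N).
have : N%:R * (r - 1) <= (2 ^ N)%:R * (r - 1).
  by rewrite ler_pM2r// ler_nat ltnW// ltn_expl.
lra.
Qed.

(** A set without supremum is covered too, [sup] being 0 there. *)
Lemma sup_ge0 {R : realType} (E : set R) :
  (forall x, E x -> 0 <= x) -> 0 <= sup E.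
Proof.
move=> E0; have [[[x Ex] E_ub]|/sup_out -> //] := pselect (has_sup E).
exact: le_trans (E0 _ Ex) (ub_le_sup E_ub Ex).
Qed.

(* [0 <= c] is needed because [sup] is 0 on sets without supremum. *)
Lemma sup_le_ge0 {R : realType} (E : set R) (c : R) :
  0 <= c -> (forall x, E x -> x <= c) -> sup E <= c.
Proof.
move=> c0 Ec; have [[E_ne _]|/sup_out -> //] := pselect (has_sup E).
exact: ge_sup E_ne Ec.
Qed.

(** * Operators selfadjoint for the semi-inner product *)

Section SelfAdjoint.
Context {R : realType} {H : hilbertType R} {A : H -> H}.
Context (A_pos : positive_operator A).
Implicit Types (S T P Q X : H -> H) (x y z v : H) (t : R).

(** With p = |Px|_A^2, the discriminant of a polynomial obtained by polarization gives p^2 <= c^2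
    |x|_A^2 p, and p cancels. *)
Lemma selfadjoint_normA_le P c x : 0 <= c -> linear P ->
  (forall x y, reA A (P x) y = reA A x (P y)) ->
  (forall x, `|reA A (P x) x| <= c * reA A x x) ->
  normA A (P x) <= c * normA A x.
Proof.
move=> c0 P_lin P_sa Pc; set y := P x; pose p := reA A y y.
have x0 : 0 <= reA A x x by exact: reA_ge0.
have p0 : 0 <= p by exact: reA_ge0.
(* Polarization: 4t<Px, y> is the difference of the quadratic form of P at
   x + ty and x - ty. *)
have poly t : 0 <= c * reA A x x + 2 * t * - p + t ^+ 2 * (c * p).
  have := Pc (x + t%:C%C *: y); have := Pc (x + (- t)%:C%C *: y).
  rewrite !(linear_funD P_lin, linear_funZ P_lin).
  rewrite !(reADl A_pos, reADr, reAZl A_pos, reAZr) -/y.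
  rewrite (P_sa y x) -/y (reAC A_pos y x) -/p !ler_norml.
  by move=> /andP[+ _] /andP[_ +]; lra.
have := discriminant_le0 _ _ _ (mulr_ge0 c0 x0) (mulr_ge0 c0 p0) poly.
move=> p2; have {p2} : p <= c ^+ 2 * reA A x x.
  have [->|p_neq0] := eqVneq p 0; first by rewrite mulr_ge0// sqr_ge0.
  have p_gt0 : 0 < p by rewrite lt_neqAle eq_sym p_neq0.
  by rewrite -(ler_pM2r p_gt0); move: p2; rewrite sqrrN; lra.
rewrite /p -!(sqr_normA A_pos) -exprMn ler_pXn2r// nnegrE ?normA_ge0//.
by rewrite mulr_ge0 ?normA_ge0.
Qed.

Lemma normA_le_norm1 :
  exists2 K, 0 < K & forall x, normA A x <= K * norm1 x.
Proof.
have [A_bnd _] := A_pos; have [M M0 AM] := bounded_operator_gt0 _ A_bnd.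
exists (Num.sqrt M) => [|x]; first by rewrite sqrtr_gt0.
rewrite -(ler_pXn2r (ltn0Sn 1)) ?nnegrE ?mulr_ge0 ?sqrtr_ge0 ?normA_ge0//.
rewrite exprMn (sqr_normA A_pos) (sqr_sqrtr (ltW M0)) expr2 mulrA.
apply: le_trans (ler_norm _) _.
apply: le_trans (reA_cauchy_schwarz (@positive_operator_id R H) (A x) x) _.
by rewrite ler_wpM2r ?normA_ge0// AM.
Qed.

Lemma selfadjoint_bounded P : bounded_operators P ->
  (forall x y, reA A (P x) y = reA A x (P y)) ->
  exists2 M, 0 <= M & forall x, normA A x = 1 -> normA A (P x) <= M.
Proof.
move=> P_bnd P_sa; have [K K0 AK] := normA_le_norm1.
have [M M0 PM] := bounded_operator_gt0 _ P_bnd.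
exists M => [|x x1]; first exact: ltW.
have iterPM n : norm1 (iter n P x) <= M ^+ n * norm1 x.
  elim: n => [|n IHn] /=; first by rewrite expr0 mul1r.
  by apply: le_trans (PM _) _; rewrite exprS -mulrA ler_pM2l.
have iter_sa n y z : reA A (iter n P y) z = reA A y (iter n P z).
  by elim: n y z => //= n IHn y z; rewrite P_sa IHn -iterSr.
(* |P^m x|^2 = <P^2m x, x> <= |P^2m x| *)
have iter_sqr m : normA A (iter m P x) ^+ 2 <= normA A (iter (m + m) P x).
  rewrite (sqr_normA A_pos) iter_sa -iterD reAC//.
  apply: le_trans (ler_norm _) _.
  apply: le_trans (reA_cauchy_schwarz A_pos _ _) _.
  by rewrite x1 mulr1.
(* |Px|_A^(2^n) <= |P^(2^n) x|_A <= K |x| M^(2^n), where the factor K |x| is independent of n and so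
   does not affect the growth rate. *)
apply: (@le_of_exp2n_bound _ _ _ (K * norm1 x)) => // n.
apply: (@le_trans _ _ (normA A (iter (2 ^ n) P x))).
  elim: n => [|n IHn]; first by rewrite expr1.
  rewrite expnS mul2n -addnn exprD -expr2; apply: le_trans (iter_sqr _).
  by rewrite ler_pXn2r// nnegrE ?exprn_ge0 ?normA_ge0.
apply: le_trans (AK _) _; rewrite -mulrA ler_pM2l// mulrC [leRHS]mulrC.
by rewrite mulrC.
Qed.

Lemma normA_i x : normA A ('i *: x) = normA A x.
Proof.
rewrite /normA -!/(reA _ _ _) (reA_il A_pos) scalerA -expr2 sqrCi.
by rewrite scaleN1r reANr opprK.
Qed.

End SelfAdjoint.

(** * The Cartesian decomposition T = P + iQ and the numerical radius *)

Section Cartesian.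
Context {R : realType} {H : hilbertType R} {A T X : H -> H}.
Context (A_pos : positive_operator A) (T_bnd : bounded_operators T).
Context (X_bnd : bounded_operators X).
Context (TX : forall x y, reA A (X x) y = reA A x (T y)).
Implicit Types (x y z v : H) (t : R).

Let T_lin : linear T. Proof. by case: T_bnd. Qed.
Let X_lin : linear X. Proof. by case: X_bnd. Qed.
Local Notation w := (numradiusA A T).
Local Notation re := (reA A).

Lemma reA_adjoint x y : re (T x) y = re x (X y).
Proof. by rewrite reAC// -TX reAC. Qed.

(** [X \o T] is selfadjoint for the form, hence bounded by some [M] on unit vectors, and |Tx|_A^2 =
    <XTx, x>_A <= M. The real and imaginary parts of <Tx, x>_A then have squares at most [M]. *)
Lemma numradiusA_has_ubound :
  has_ubound
    [set complex.Re `|innerA A (T x) x| | x in [set x | normA A x = 1]].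
Proof.
have [M M0 XTM] : exists2 M, 0 <= M &
    forall x, normA A x = 1 -> normA A ((X \o T) x) <= M.
  apply: selfadjoint_bounded => // [|x y /=]; first exact: bounded_comp.
  by rewrite TX reA_adjoint.
exists (Num.sqrt (M + M)) => _ [x x1 <-].
have TM : re (T x) (T x) <= M.
  rewrite -TX reAC// -[X in X <= _]reAC//; apply: le_trans (XTM _ x1).
  apply: le_trans (ler_norm _) _.
  apply: le_trans (reA_cauchy_schwarz A_pos _ _) _.
  by rewrite x1 mulr1.
have le_M y : normA A y = 1 -> re (T x) y ^+ 2 <= M.
  move=> y1; apply: le_trans (reA_cauchy_schwarz_sqr A_pos _ _) _.
  by rewrite -(sqr_normA A_pos y) y1 expr1n mulr1.
rewrite norm_innerA ler_wsqrtr// lerD// le_M//.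
by rewrite normA_i.
Qed.

Lemma numradiusA_ge0 : 0 <= w.
Proof. by apply: sup_ge0 => _ [x _ <-]; rewrite norm_innerA sqrtr_ge0. Qed.

(* Homogeneity reduces to |x|_A = 1 unless |x|_A = 0, where Cauchy-Schwarz
   makes the left-hand side vanish. *)
Lemma quadratic_le_numradius (phi : H -> R) x :
  (forall t x, phi (t%:C%C *: x) = t ^+ 2 * phi x) ->
  (forall x, `|phi x| <= normA A (T x) * normA A x) ->
  (forall x, `|phi x| <= complex.Re `|innerA A (T x) x|) ->
  `|phi x| <= w * re x x.
Proof.
move=> phiZ phi_cs phi_le; rewrite -(sqr_normA A_pos).
have [x0|x_neq0] := eqVneq (normA A x) 0.
  by rewrite x0 expr0n mulr0 (le_trans (phi_cs x))// x0 mulr0.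
pose s := (normA A x)^-1; have x_ge0 := normA_ge0 (A := A) x.
have sx1 : normA A (s%:C%C *: x) = 1.
  by rewrite normAZ// ger0_norm ?invr_ge0// mulVf.
have : `|phi (s%:C%C *: x)| <= w.
  apply: le_trans (phi_le _) _; apply: (ub_le_sup numradiusA_has_ubound).
  by exists (s%:C%C *: x).
rewrite phiZ normrM ger0_norm ?sqr_ge0// /s exprVn mulrC ler_pdivrMr//.
by rewrite lt_neqAle sqr_ge0 eq_sym sqrf_eq0 x_neq0.
Qed.

Lemma reA_le_numradius x : `|re (T x) x| <= w * re x x.
Proof.
apply: (quadratic_le_numradius (fun x => re (T x) x)) => [t y|y|y].
- by rewrite (linear_funZ T_lin) reAZl// reAZr mulrA -expr2.
- exact: reA_cauchy_schwarz.
- by rewrite norm_innerA -sqrtr_sqr ler_wsqrtr// lerDl sqr_ge0.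
Qed.

Lemma imA_le_numradius x : `|re (T x) ('i *: x)| <= w * re x x.
Proof.
apply: (quadratic_le_numradius (fun x => re (T x) ('i *: x))) => [t y|y|y].
- rewrite (linear_funZ T_lin) scalerA mulrC -scalerA reAZl// reAZr.
  by rewrite mulrA -expr2.
- by rewrite -[normA A y](normA_i A_pos); exact: reA_cauchy_schwarz.
- by rewrite norm_innerA -sqrtr_sqr ler_wsqrtr// lerDr sqr_ge0.
Qed.

Local Notation P := (fun x => 2^-1 *: (T x + X x)).
Local Notation Q := (fun x => (2 * 'i)^-1 *: (T x - X x)).

Lemma inv2_complex : 2^-1 = (2^-1)%:C%C :> R[i].
Proof. by rewrite fmorphV rmorph_nat. Qed.

Lemma inv2i_complex : (2 * 'i)^-1 = - ((2^-1)%:C%C * 'i) :> R[i].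
Proof. by rewrite invfM invCi mulrN inv2_complex. Qed.

Lemma reA_cartesian_re x y : re (P x) y = 2^-1 * (re (T x) y + re (X x) y).
Proof. by rewrite inv2_complex reAZl// reADl. Qed.

Lemma reA_cartesian_im x y :
  re (Q x) y = 2^-1 * (re (T x) ('i *: y) - re (X x) ('i *: y)).
Proof.
rewrite inv2i_complex scaleNr -scalerA reANl// reAZl// reA_il//.
by rewrite reADl// reANl//; lra.
Qed.

Lemma cartesian_re_linear : linear P.
Proof.
move=> a x y; rewrite T_lin X_lin.
by rewrite addrACA -scalerDr [LHS]scalerDr !scalerA mulrC.
Qed.

Lemma cartesian_im_linear : linear Q.
Proof.
move=> a x y; rewrite T_lin X_lin.
by rewrite opprD addrACA -scalerBr [LHS]scalerDr !scalerA mulrC.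
Qed.

Lemma cartesian_re_selfadjoint x y : re (P x) y = re x (P y).
Proof.
rewrite reA_cartesian_re (reAC A_pos x) reA_cartesian_re !TX.
by rewrite (reAC A_pos y) (reAC A_pos x) addrC.
Qed.

Lemma cartesian_re_diag x : re (P x) x = re (T x) x.
Proof.
by rewrite reA_cartesian_re TX (reAC A_pos x); lra.
Qed.

Lemma normA_cartesian_re_le x : normA A (P x) <= w * normA A x.
Proof.
apply: selfadjoint_normA_le => //;
  [exact: numradiusA_ge0|exact: cartesian_re_linear|..].
  exact: cartesian_re_selfadjoint.
by move=> u; rewrite cartesian_re_diag reA_le_numradius.
Qed.

Lemma reA_adjoint_i x y : re (X x) ('i *: y) = - re (T y) ('i *: x).
Proof.
by rewrite TX (linear_funZ T_lin) (reAC A_pos) (reA_il A_pos).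
Qed.

Lemma normA_cartesian_im_le x : normA A (Q x) <= w * normA A x.
Proof.
apply: selfadjoint_normA_le => //;
  [exact: numradiusA_ge0|exact: cartesian_im_linear|..].
  move=> u v; rewrite reA_cartesian_im (reAC A_pos u) reA_cartesian_im.
  (* The form of [Q] becomes half of [re (T u) ('i *: v) + re (T v) ('i *: u)], which is symmetric
     in [u] and [v]. *)
  rewrite !reA_adjoint_i.
  lra.
move=> u; rewrite reA_cartesian_im reA_adjoint_i opprK.
set r := re (T u) _; have -> : 2^-1 * (r + r) = r by lra.
exact: imA_le_numradius.
Qed.

(* The left-hand side is the absolute value of |Px|^2 - |Qx|^2. *)
Lemma reA_sqr_le_numradius x : `|re (T (T x)) x| <= w ^+ 2 * re x x.
Proof.
have -> : re (T (T x)) x = normA A (P x) ^+ 2 - normA A (Q x) ^+ 2.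
  (* The scalars 1/(2i) and 1/2 differ by the unit -i, which the seminorm ignores. *)
  have -> : normA A (Q x) = normA A ((2^-1)%:C%C *: (T x - X x)).
    by rewrite inv2i_complex scaleNr mulrC -scalerA normAN// normA_i.
  rewrite inv2_complex !(sqr_normA A_pos) !reAZl// !reAZr.
  rewrite !(reADl A_pos) !reADr !(reANl A_pos) !reANr reA_adjoint.
  by rewrite (reAC A_pos (X x)); lra.
have sqr_le (a : R) : 0 <= a -> a <= w * normA A x ->
      0 <= a ^+ 2 <= w ^+ 2 * re x x.
  move=> a0 aw; rewrite sqr_ge0 -(sqr_normA A_pos) -exprMn.
  by rewrite ler_pXn2r// nnegrE (le_trans a0 aw).
have /andP[p0 pw] := sqr_le _ (normA_ge0 _) (normA_cartesian_re_le x).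
have /andP[q0 qw] := sqr_le _ (normA_ge0 _) (normA_cartesian_im_le x).
by rewrite ler_norml; apply/andP; split; lra.
Qed.

End Cartesian.

(** * Operator seminorm bounds and the final inequality *)

Lemma opnormA_ge0 {R : realType} {H : hilbertType R} (A T : H -> H) :
  0 <= opnormA A T.
Proof. by apply: sup_ge0 => _ [x _ <-]; exact: sqrtr_ge0. Qed.

Lemma opnormA_le {R : realType} {H : hilbertType R} (A T : H -> H) (c : R) :
  0 <= c -> (forall x, normA A (T x) <= c * normA A x) -> opnormA A T <= c.
Proof.
move=> c0 Tc; apply: sup_le_ge0 => // _ [x x1 <-].
by rewrite (le_trans (Tc x))// x1 mulr1.
Qed.

Theorem corollary2p10 (R : realType) (H : hilbertType R) (A T : H -> H)
    (A_pos : positive_operator A) (A_neq0 : A <> (fun _ : H => 0 : H))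
    (T_BA : BA A T) :
  2^-1 * opnormA A (ReA A (T \o T))
    + 2^-1 * numradiusA A T * `|opnormA A (ReA A T) - opnormA A (ImA A T)|
  <= numradiusA A T ^+ 2.
Proof.
have [T_bnd _] := T_BA; have [X_bnd _] := sharpP A_pos T_BA.
have TX := reA_sharp A_pos T_BA.
have T2_BA := BA_comp _ _ _ T_BA T_BA.
have [T2_bnd _] := T2_BA; have [Y_bnd _] := sharpP A_pos T2_BA.
have T2Y := reA_sharp A_pos T2_BA.
set w := numradiusA A T; have w0 : 0 <= w by exact: numradiusA_ge0.
have P_le : opnormA A (ReA A T) <= w.
  by apply: opnormA_le => // x; exact: normA_cartesian_re_le.
have Q_le : opnormA A (ImA A T) <= w.
  by apply: opnormA_le => // x; exact: normA_cartesian_im_le.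
(* The Cartesian bound for [T \o T] would bring in its own numerical radius; the bound on the form
   of [T \o T] yields [w ^+ 2] directly. *)
have P2_le : opnormA A (ReA A (T \o T)) <= w ^+ 2.
  apply: opnormA_le => [|x]; first exact: sqr_ge0.
  apply: selfadjoint_normA_le => //; first exact: sqr_ge0.
  - exact: cartesian_re_linear T2_bnd Y_bnd.
  - exact: cartesian_re_selfadjoint.
  - move=> u; have -> : reA A (ReA A (T \o T) u) u = reA A (T (T u)) u.
      exact: cartesian_re_diag A_pos T2Y u.
    exact: reA_sqr_le_numradius A_pos T_bnd X_bnd TX u.
have P_ge0 := opnormA_ge0 A (ReA A T); have Q_ge0 := opnormA_ge0 A (ImA A T).
(* Both seminorms lie between 0 and [w]. *)
have PQ : `|opnormA A (ReA A T) - opnormA A (ImA A T)| <= w.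
  by rewrite ler_norml; apply/andP; split; lra.
have := ler_wpM2l w0 PQ; lra.
Qed.
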